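(* Let $R$ be a ring. Every $R$-module of finite uniform dimension is equal to a direct sum of finitely many indecomposable $R$-modules.
   Context: Rings are non-zero, unital and associative, not necessarily commutative; modules are left unital modules. The uniform dimension $\dim_R(M)$ of an $R$-module $M$ is the supremum of the set of all integers $k \ge 1$ such that $N_1 \oplus \cdots \oplus N_k$ embeds into $M$ for some non-zero $R$-submodules $N_1, \ldots, N_k$ of $M$, with $\sup \varnothing := 0$. An $R$-module $M$ is indecomposable if $M$ is neither a zero module nor the direct sum of two non-zero $R$-modules. ''Equal to a direct sum'' refers to an internal direct sum of submodules; the zero module is the empty direct sum. *)

(* Defs.v *)
From HB Require Import structures.
From mathcomp Require Import all_boot all_order all_algebra.
From mathcomp Require Import boolp classical_sets constructive_ereal.

Set Implicit Arguments.
Unset Strict Implicit.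
Unset Printing Implicit Defensive.

Import Order.TTheory GRing.Theory Num.Theory.

Local Open Scope ring_scope.
Local Open Scope classical_set_scope.

Definition nonzero (V : nmodType) : Prop := exists x : V, x != 0.

(* Submodules of [M] are the inhabitants of [submodClosed M]. These are boolean
   predicates; with the classical axioms of [boolp] every subset closed under
   the module operations is of this form (lemma [submodClosed_of_set]). *)
Lemma submodClosed_of_set (R : nzRingType) (M : lmodType R) (A : set M) :
  A 0 -> (forall x y, A x -> A y -> A (x + y)) ->
  (forall a x, A x -> A (a *: x)) ->
  exists N : submodClosed M, forall x, x \in N <-> A x.
Proof.
move=> A0 AD AZ; pose p : {pred M} := fun x => `[< A x >].
have pP : subsemimod_closed p.
  split; first split=> [|x y /asboolP Ax /asboolP Ay].
  - exact/asboolP.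
  - exact/asboolP/AD.
  - by move=> a x /asboolP Ax; apply/asboolP/AZ.
pose B := GRing.isSubSemiModClosed.Build R M p pP.
exists (HB.pack_for (submodClosed M) p B).
by move=> x; split=> /asboolP.
Qed.

Section Submodule.
Variables (R : nzRingType) (M : lmodType R) (N : submodClosed M).

Inductive submodule : predArgType := Submodule u & u \in N.

Definition submodule_val (w : submodule) : M := let: Submodule u _ := w in u.

HB.instance Definition _ := [isSub of submodule for submodule_val].
HB.instance Definition _ := [Choice of submodule by <:].
HB.instance Definition _ := [SubChoice_isSubLmodule of submodule by <:].

End Submodule.

Section ExternalDirectSum.
Variables (R : nzRingType) (M : lmodType R) (k : nat) (N : 'I_k -> submodClosed M).

(* The external direct sum of [N 0], ..., [N k.-1], realised as the submodule
   of [M ^ k] that consists of the families [f] with [f i] in [N i]. *)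
Definition dsum_pred : {pred {ffun 'I_k -> M}} :=
  fun f => [forall i, f i \in N i].

Lemma dsum_closed : subsemimod_closed dsum_pred.
Proof.
split; first split=> [|f g /forallP fN /forallP gN].
- by apply/forallP=> i; rewrite ffunE rpred0.
- by apply/forallP=> i; rewrite ffunE rpredD.
- by move=> a f /forallP fN; apply/forallP=> i; rewrite ffunE rpredZ.
Qed.

HB.instance Definition _ :=
  GRing.isSubSemiModClosed.Build R {ffun 'I_k -> M} dsum_pred dsum_closed.

Definition dsum : lmodType R := submodule dsum_pred.

End ExternalDirectSum.

Definition embeds (R : nzRingType) (U V : lmodType R) : Prop :=
  exists f : {linear U -> V}, injective f.

(* [0] is the value of the supremum on the empty set; [+oo] is its value on an
   unbounded set. *)
Definition uniform_dim (R : nzRingType) (M : lmodType R) : \bar int :=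
  supremum 0%E
    [set k%:Z%:E | k in [set k : nat | (1 <= k)%N /\
      exists N : 'I_k -> submodClosed M,
        (forall i, nonzero (submodule (N i))) /\ embeds (dsum N) M]].

Definition indecomposable (R : nzRingType) (M : lmodType R) : Prop :=
  nonzero M /\
  ~ exists (A B : lmodType R) (f : {linear (A * B)%type -> M}),
      [/\ nonzero A, nonzero B & bijective f].

(* [M] is the internal direct sum of the submodules [N 0], ..., [N n.-1]; for
   [n = 0] this says that [M] is the zero module. *)
Definition is_internal_dsum (R : nzRingType) (M : lmodType R) (n : nat)
    (N : 'I_n -> submodClosed M) : Prop :=
  forall x : M, exists! f : {ffun 'I_n -> M},
    (forall i, f i \in N i) /\ x = \sum_(i < n) f i.

(* Main.v *)
Require Import Defs.
From HB Require Import structures.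
From mathcomp Require Import all_boot all_order all_algebra.
From mathcomp Require Import boolp classical_sets constructive_ereal.

(** If [M] is the internal direct sum of [n] nonzero submodules, then adding up
    components embeds their external direct sum into [M] ([internal_dsum_embeds]),
    so [n] cannot exceed the uniform dimension of [M]. There is therefore a
    decomposition of [M] into nonzero summands with as many summands as
    possible. Each summand of such a decomposition is indecomposable: a
    summand that is not indecomposable splits into two nonzero submodules
    ([nonindecomposable_split]), and putting these two in its place gives a
    decomposition of [M] with one more summand ([internal_dsum_refine]).

    The maximum exists as soon as some decomposition does: [M] itself is one
    when it is nonzero, and the empty family is one when [M] is zero. *)

Set Implicit Arguments.
Unset Strict Implicit.
Unset Printing Implicit Defensive.

Import Order.TTheory GRing.Theory Num.Theory.

Local Open Scope ring_scope.
Local Open Scope classical_set_scope.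

(** A finite value of [supremum] does not by itself bound a set, since it is also
    the default returned when no supremum exists. An unbounded set of naturals
    does have a supremum in [\bar int], however, namely [+oo]: no integer bounds
    it, because [int] is archimedean. *)
Lemma finite_supremum_bounded (S : set nat) :
  supremum 0%E [set k%:Z%:E | k in S] \is a fin_num ->
  exists b : nat, forall k, S k -> (k <= b)%N.
Proof.
set E := [set k%:Z%:E | k in S] => hE.
apply: contrapT => nb.
have unb (b : nat) : exists2 k, S k & (b < k)%N.
  apply: contrapT => h; apply: nb; exists b => k Sk.
  by rewrite leqNgt; apply/negP => bk; apply: h; exists k.
have supE : supremums E +oo%E.
  split=> [x _|y yE]; first exact: leey.
  have h b : (b%:Z%:E < y)%E.
    have [k Sk bk] := unb b.
    apply: (@lt_le_trans _ _ k%:Z%:E); first by rewrite lte_fin ltz_nat.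
    by apply: yE; exists k.
  case: y yE h => [z|//|] yE h; last by have := h 0%N.
  have := h `|z|%N; rewrite lte_fin => /lt_le_trans/(_ (ler_norm z)).
  by rewrite abszE ltxx.
have sup_oo : supremum 0%E E = +oo%E.
  rewrite /supremum ifF; last first.
    have [k Sk _] := unb 0%N.
    by apply/negP => /eqP E0; have : E k%:Z%:E by [exists k]; rewrite E0.
  by apply: xget_subset1 => //; exact: is_subset1_supremums.
by move: hE; rewrite sup_oo.
Qed.

Section InternalDirectSums.
Variables (R : nzRingType) (M : lmodType R).

(** Uniqueness of the components is, by subtraction, independence: only the zero
    family sums to zero. In this form no uniqueness has to be carried along when
    a decomposition is modified. *)
Lemma internal_dsumP n (N : 'I_n -> submodClosed M) :
  is_internal_dsum N <->
  (forall x, exists2 f : {ffun 'I_n -> M},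
     (forall i, f i \in N i) & x = \sum_i f i) /\
  (forall f : {ffun 'I_n -> M},
     (forall i, f i \in N i) -> \sum_i f i = 0 -> forall i, f i = 0).
Proof.
split=> [dN|[span indep] x].
- split=> [x|f fN f0 i]; first by have [f [[]]] := dN x; exists f.
  have [g [_ g_uniq]] := dN 0.
  have -> : f = [ffun=> 0]; last by rewrite ffunE.
  rewrite -(g_uniq f); last by split.
  apply: g_uniq; split=> [j|]; first by rewrite ffunE rpred0.
  by rewrite big1 // => j _; rewrite ffunE.
- have [f fN xE] := span x; exists f; split=> // g [gN xE'].
  apply/ffunP => i; apply/eqP; rewrite -subr_eq0; apply/eqP.
  have := indep [ffun j => f j - g j] _ _ i; rewrite ffunE; apply.
    by move=> j; rewrite ffunE -scaleN1r rpredD ?rpredZ.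
  under eq_bigr do rewrite ffunE.
  by rewrite sumrB -xE -xE' subrr.
Qed.

Section Sum.
Variables (n : nat) (N : 'I_n -> submodClosed M).

Definition dsum_sum (w : dsum N) : M := \sum_i (val w : {ffun 'I_n -> M}) i.

Lemma dsum_sum_linear : linear dsum_sum.
Proof.
move=> a u v; rewrite /dsum_sum scaler_sumr -big_split /=.
by apply: eq_bigr => i _; rewrite /= !ffunE.
Qed.

HB.instance Definition _ :=
  GRing.isLinear.Build R (dsum N) M _ dsum_sum dsum_sum_linear.

Lemma internal_dsum_embeds : is_internal_dsum N -> embeds (dsum N) M.
Proof.
move=> dN; exists dsum_sum => u v uv; apply: val_inj.
have [f [_ f_uniq]] := dN (dsum_sum u).
rewrite -(f_uniq (val u)); last first.
  by split=> // i; have /forallP := valP u; exact.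
by apply: f_uniq; split=> // i; have /forallP := valP v; exact.
Qed.

End Sum.

Lemma range_submodule (A : lmodType R) (h : A -> M) : linear h ->
  exists H : submodClosed M, forall x, x \in H <-> exists a, x = h a.
Proof.
move=> h_lin; pose hB := GRing.isLinear.Build R A M _ h h_lin.
pose hL : {linear A -> M} := HB.pack h hB.
apply: submodClosed_of_set => [|_ _ [a ->] [b ->]|c _ [a ->]].
- by exists 0; exact/esym/(linear0 hL).
- by exists (a + b); exact/esym/(linearD hL).
- by exists (c *: a); exact/esym/(linearZZ hL).
Qed.

(** An isomorphism from an external direct sum [U * V] onto [N] carries the two
    factors to complementary submodules of [N], regarded here as submodules of
    the ambient module [M] so that they can take the place of [N] in a
    decomposition of [M]. *)
Lemma nonindecomposable_split (N : submodClosed M) :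
  nonzero (submodule N) -> ~ indecomposable (submodule N) ->
  exists A B : submodClosed M,
    [/\ nonzero (submodule A), nonzero (submodule B),
     forall x, x \in N <-> exists a b, [/\ a \in A, b \in B & x = a + b] &
     forall a b, a \in A -> b \in B -> a + b = 0 -> a = 0 /\ b = 0].
Proof.
move=> N_neq0 Ndec.
have [U [V [f [[a0 a0P] [b0 b0P] f_bij]]]] :
    exists (U V : lmodType R) (f : {linear (U * V)%type -> submodule N}),
      [/\ nonzero U, nonzero V & bijective f].
  by apply: contrapT => h; apply: Ndec; split.
have [g gK fK] := f_bij.
have f_pair a b : f (a, b) = f (a, 0) + f (0, b).
  by rewrite -linearD; congr (f (_, _)); rewrite /= ?addr0 ?add0r.
have f_inj0 p : val (f p) = 0 -> p = 0.
  by move=> fp0; apply: (can_inj gK); rewrite linear0; exact: val_inj.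
have linA : linear (fun a => val (f (a, 0))).
  move=> c a a'; rewrite -!linearP; congr (val (f (_, _))).
  by rewrite /= scaler0 addr0.
have linB : linear (fun b => val (f (0, b))).
  move=> c b b'; rewrite -!linearP; congr (val (f (_, _))).
  by rewrite /= scaler0 addr0.
have [A' A'E] := range_submodule linA.
have [B' B'E] := range_submodule linB.
have memA a : val (f (a, 0)) \in A' by apply/A'E; exists a.
have memB b : val (f (0, b)) \in B' by apply/B'E; exists b.
exists A', B'; split.
- exists (Submodule (memA a0)); apply: contra_neq a0P => /(congr1 val) /=.
  by move=> /f_inj0[].
- exists (Submodule (memB b0)); apply: contra_neq b0P => /(congr1 val) /=.
  by move=> /f_inj0[].
- move=> x; split=> [xN|[_ [_ [/A'E[a ->] /B'E[b ->] ->]]]]; last first.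
    by rewrite -linearD -f_pair; exact: valP.
  have := fK (Submodule xN); case: (g _) => a b fab.
  exists (val (f (a, 0))), (val (f (0, b))); split=> //.
  by rewrite -linearD -f_pair fab.
- move=> _ _ /A'E[a ->] /B'E[b ->]; rewrite -linearD -f_pair.
  by move=> /f_inj0[-> ->]; rewrite !linear0.
Qed.

(** In the refined family [A] becomes the new summand, of index [ord0], and [B]
    takes over the index of [N i]. The families of components of the two
    decompositions correspond by adding the [A]- and [B]-components to get the
    component in [N i]. *)
Lemma internal_dsum_refine n (N : 'I_n -> submodClosed M) (i : 'I_n)
    (A B : submodClosed M) :
  is_internal_dsum N ->
  (forall x, x \in N i <-> exists a b, [/\ a \in A, b \in B & x = a + b]) ->
  (forall a b, a \in A -> b \in B -> a + b = 0 -> a = 0 /\ b = 0) ->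
  is_internal_dsum (fun k : 'I_n.+1 =>
    if unlift ord0 k is Some j then (if j == i then B else N j) else A).
Proof.
move=> /internal_dsumP[span indep] NiE AB0; apply/internal_dsumP; split.
- move=> x; have [f fN ->] := span x.
  have [a [b [aA bB fiE]]] := (NiE (f i)).1 (fN i).
  exists [ffun k => if unlift ord0 k is Some j then
                      (if j == i then b else f j) else a].
    by move=> k; rewrite ffunE; case: unliftP => // j _; case: eqP.
  rewrite big_ord_recl ffunE unlift_none.
  under [in RHS]eq_bigr do rewrite ffunE liftK.
  rewrite (bigD1 i) //= fiE [in RHS](bigD1 i) //= eqxx addrA.
  by congr (_ + _); apply: eq_bigr => j /negPf ->.
- move=> g gN g0.
  have gA : g ord0 \in A by have := gN ord0; rewrite unlift_none.
  have gB : g (lift ord0 i) \in B by have := gN (lift ord0 i); rewrite liftK eqxx.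
  pose f := [ffun j => if j == i then g ord0 + g (lift ord0 i)
                       else g (lift ord0 j)].
  have f0 : forall j, f j = 0.
    apply: indep => [j|].
      rewrite ffunE; case: eqP => [->|/eqP ji].
        by apply/NiE; exists (g ord0), (g (lift ord0 i)).
      by have := gN (lift ord0 j); rewrite liftK (negPf ji).
    rewrite -[RHS]g0 big_ord_recl (bigD1 i) //= [in RHS](bigD1 i) //= addrA.
    rewrite ffunE eqxx; congr (_ + _).
    by apply: eq_bigr => j /negPf ji; rewrite ffunE ji.
  have [gA0 gB0] : g ord0 = 0 /\ g (lift ord0 i) = 0.
    by apply: AB0 => //; have := f0 i; rewrite ffunE eqxx.
  move=> k; case: (unliftP ord0 k) => [j|] -> //.
  by have := f0 j; rewrite ffunE; case: eqP => [->|].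
Qed.

End InternalDirectSums.

Theorem corollary4p14 (R : nzRingType) (M : lmodType R)
    (hM : uniform_dim M \is a fin_num) :
  exists (n : nat) (N : 'I_n -> submodClosed M),
    (forall i : 'I_n, indecomposable (submodule (N i))) /\ is_internal_dsum N.
Proof.
have [b bP] := finite_supremum_bounded hM.
pose P n := `[< exists N : 'I_n -> submodClosed M,
  (forall i, nonzero (submodule (N i))) /\ is_internal_dsum N >].
have P_bounded n : P n -> (n <= b)%N.
  case: n => // n /asboolP[N [N0 dN]]; apply: bP; split=> //.
  by exists N; split=> //; exact: internal_dsum_embeds.
have exP : exists n, P n.
  have [T TE] := @submodClosed_of_set R M setT I (fun _ _ _ _ => I) (fun _ _ _ => I).
  have [[x x0]|M0] := pselect (nonzero M).
    exists 1%N; apply/asboolP; exists (fun=> T); split.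
      by move=> _; have xT := (TE x).2 I; exists (Submodule xT).
    apply/internal_dsumP; split=> [y|f _].
      exists [ffun=> y]; first by move=> i; exact/TE.
      by rewrite big_ord1 ffunE.
    by rewrite big_ord1 => f0 i; rewrite ord1.
  exists 0%N; apply/asboolP; exists (fun=> T); split; first by case.
  apply/internal_dsumP; split=> [y|f _ _ []//].
  exists [ffun=> 0]; first by case.
  by rewrite big_ord0; apply: contrapT => /eqP y0; apply: M0; exists y.
have [n /asboolP[N [N0 dN]] n_max] := ex_maxnP exP P_bounded.
exists n, N; split=> // i; apply: contrapT => iN.
have [A [B [A0 B0 NiE AB0]]] := nonindecomposable_split (N0 i) iN.
suff /n_max : P n.+1 by rewrite ltnn.
apply/asboolP; eexists; split; last exact: internal_dsum_refine dN NiE AB0.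
by move=> k /=; case: (unlift ord0 k) => // j; case: eqP.
Qed.
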